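(* Let $p\ge 5$ be a prime, let $C,D\in\mathbb{F}_p$, and let $N_0(f)$ be the number of solutions $(x,y,z)\in\mathbb{F}_p^3$ to $f(x,y,z)=0$, where $$f(x,y,z)=x^2+y^2+z^2-xyz+C(x+y+z)-D.$$ Put $D_\bullet=4-2C-\frac{C^2}{4}\in\mathbb{F}_p$. Then the following hold. (i) If $D=D_\bullet$, then $N_0(f)=p^2+1+\sigma(C^2-8C)\cdot p$. (ii) If $D\neq D_\bullet$, then $$N_0(f)=p^2+1+\sigma(D-D_\bullet)\big(1+N_0(\kappa)\big)\cdot p,$$ where $N_0(\kappa)$ is the number of distinct roots in $\mathbb{F}_p$ of the cubic $$\kappa(x)=x^3+(C-2)x^2-(2C+D)x+C^2+2D.$$
   Context: $\sigma:\mathbb{F}_p\to\{-1,0,1\}\subset\mathbb{Z}$ denotes the quadratic character: $\sigma(a)=1$ if $a$ is a nonzero square, $\sigma(a)=-1$ if $a$ is a non-square, $\sigma(0)=0$. *)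

(* Defs.v *)
From mathcomp Require Import all_boot all_order all_algebra.

Set Implicit Arguments.
Unset Strict Implicit.
Unset Printing Implicit Defensive.

Import GRing.Theory.

Local Open Scope ring_scope.

Definition sigma (p : nat) (a : 'F_p) : int :=
  if a == 0 then 0 else if [exists b : 'F_p, a == b ^+ 2] then 1 else -1.

Definition N0 (p : nat) (T : finType) (g : T -> 'F_p) : nat :=
  #|[set v : T | g v == 0]|.

Definition f (p : nat) (C D : 'F_p) (v : 'F_p * 'F_p * 'F_p) : 'F_p :=
  let: (x, y, z) := v in
  x ^+ 2 + y ^+ 2 + z ^+ 2 - x * y * z + C * (x + y + z) - D.

Definition kappa (p : nat) (C D : 'F_p) : {poly 'F_p} :=
  'X^3 + (C - 2) *: 'X^2 - (2 * C + D) *: 'X + (C ^+ 2 + 2 * D)%:P.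

Definition D_bullet (p : nat) (C : 'F_p) : 'F_p := 4 - 2 * C - C ^+ 2 / 4.

(* Main.v *)
(** For fixed [x] and [y] the equation [f = 0] is a monic quadratic in [z], with
    [1 + sigma Delta] roots, where its discriminant [Delta] is a quadratic
    polynomial in [y] with leading coefficient [x^2 - 4] and discriminant
    [16 (x + 2) kappa(x)].  The classical evaluation of quadratic character sums
    over quadratic polynomials gives, for [x] different from [2] and [-2], the
    value [sigma (x^2 - 4) (p [kappa(x) = 0] - 1)] for the sum of [sigma Delta]
    over [y]; the fibres over [2] and [-2] are degenerate and counted apart.
    The identity [(x - 2) (D - D_bullet) = (x + 2) (x - 2 + C / 2)^2 - kappa(x)]
    then determines [sigma (x^2 - 4)] at the roots of [kappa]. *)
Require Import Defs.
From mathcomp Require Import all_boot all_order all_algebra.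
From mathcomp Require Import ring.

Import GRing.Theory Num.Theory.

Local Open Scope ring_scope.

(** * The quadratic character of a finite field of odd characteristic *)

(** Has the body of [sigma], so the two agree by conversion on ['F_p]. *)
Definition quadchar {F : finFieldType} (a : F) : int :=
  if a == 0 then 0 else if [exists b : F, a == b ^+ 2] then 1 else -1.

Lemma quadchar0 {F : finFieldType} : quadchar (0 : F) = 0.
Proof. by rewrite /quadchar eqxx. Qed.

Lemma quadchar_sqr {F : finFieldType} (a : F) : a != 0 -> quadchar (a ^+ 2) = 1.
Proof.
move=> a0; rewrite /quadchar expf_eq0 /= (negbTE a0).
by case: existsP => // -[]; exists a.
Qed.

Lemma quadchar_sqrMl {F : finFieldType} (a b : F) :
  a != 0 -> quadchar (a ^+ 2 * b) = quadchar b.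
Proof.
move=> a0; rewrite /quadchar mulf_eq0 expf_eq0 /= (negbTE a0) /=.
case: eqP => // _; congr (if _ then _ else _).
apply/existsP/existsP => -[c /eqP e].
  exists (c / a); rewrite expr_div_n -e mulrAC mulfV ?mul1r //.
  by rewrite expf_eq0.
by exists (a * c); rewrite e exprMn.
Qed.

Lemma sum_indicator1 {F : finFieldType} (a : F) :
  \sum_(v : F) (v == a)%:Z = 1.
Proof.
by rewrite (bigD1 a) //= eqxx big1 ?addr0 // => v /negbTE ->.
Qed.

Lemma sum_sqrt {F : finFieldType} (c : F) : 2 != 0 :> F ->
  \sum_(v : F) (v ^+ 2 == c)%:Z = 1 + quadchar c.
Proof.
move=> h2; rewrite /quadchar; case: eqP => [->|/eqP c0].
  rewrite addr0 -[RHS](sum_indicator1 (0 : F)).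
  by apply: eq_bigr => v _; rewrite expf_eq0.
case: existsP => [[b /eqP e]|ne].
  have b0 : b != 0 by apply: contraNneq c0 => b0; rewrite e b0 expr0n.
  have bNb : b != - b.
    by rewrite -subr_eq0 opprK -mulr2n -mulr_natl mulf_neq0.
  rewrite /= -{1}(sum_indicator1 b) -(sum_indicator1 (- b)) -big_split /=.
  apply: eq_bigr => v _; rewrite e eqf_sqr.
  by case: (eqVneq v b) => [->|_]; rewrite ?(negbTE bNb).
rewrite subrr big1 // => v _.
by case: eqP => // e; case: ne; exists v; rewrite e.
Qed.

(** Summing the number of square roots over all [c] counts each [v] once, at its square. *)
Lemma sum_quadchar {F : finFieldType} : 2 != 0 :> F ->
  \sum_(c : F) quadchar c = 0.
Proof.
move=> h2.
suff: \sum_(c : F) (1 + quadchar c) = \sum_(v : F) 1.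
  by rewrite big_split /= => /eqP; rewrite -subr_eq0 addrAC subrr add0r => /eqP.
under eq_bigr => c _ do rewrite -sum_sqrt //.
rewrite exchange_big /=; apply: eq_bigr => v _.
by under eq_bigr => c _ do rewrite eq_sym; rewrite sum_indicator1.
Qed.

Lemma quadcharM {F : finFieldType} (a b : F) : 2 != 0 :> F ->
  quadchar (a * b) = quadchar a * quadchar b.
Proof.
move=> h2.
have sq (x y : F) : [exists c, x == c ^+ 2] ->
    quadchar (x * y) = quadchar x * quadchar y.
  move=> /existsP[c /eqP ->]; case: (eqVneq c 0) => [->|c0].
    by rewrite expr0n /= mul0r quadchar0 mul0r.
  by rewrite quadchar_sqrMl // quadchar_sqr // mul1r.
case: (boolP [exists c, a == c ^+ 2]) => [/sq -> //|na].
have a0 : a != 0.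
  by apply: contraNneq na => ->; apply/existsP; exists 0; rewrite expr0n.
have qa : quadchar a = -1 by rewrite /quadchar (negbTE a0) (negbTE na).
(* Both sides sum to zero, so [quadchar (a * x) <= - quadchar x] for every
   [x] forces equality everywhere. *)
have le0 (x : F) : 0 <= - (quadchar (a * x) + quadchar x).
  case: (boolP [exists c, x == c ^+ 2]) => [/sq sx|nx].
    by rewrite mulrC sx qa mulrN1 addNr oppr0.
  rewrite oppr_ge0 {2}/quadchar (negbTE nx).
  case: eqP => [->|_]; first by rewrite mulr0 quadchar0.
  by rewrite /quadchar; case: ifP => // _; case: ifP.
have sum0 : \sum_(x : F) - (quadchar (a * x) + quadchar x) = 0.
  rewrite sumrN big_split /= sum_quadchar // addr0.
  have bij : {on [pred _ | true], bijective (fun x : F => a * x)}.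
    by exists (fun x => a^-1 * x) => x _; rewrite ?mulKf ?mulVKf.
  by rewrite -(reindex _ bij (F := @quadchar F)) sum_quadchar // oppr0.
have /eqP := sum0; rewrite psumr_eq0 => [/allP /(_ b)|x _]; last exact: le0.
rewrite mem_index_enum => /(_ isT) /=.
by rewrite oppr_eq0 addr_eq0 => /eqP ->; rewrite qa mulN1r.
Qed.

(** * Character sums over polynomials of degree at most two *)

Lemma sum_hyperbola {F : finFieldType} (d : F) :
  \sum_(u : F) \sum_(v : F) (u * v == d)%:Z
    = #|F|%:Z * (1 + (d == 0)%:Z) - 1.
Proof.
have inner (u : F) : \sum_(v : F) (u * v == d)%:Z
    = 1 + (u == 0)%:Z * (#|F|%:Z * (d == 0)%:Z - 1).
  case: (eqVneq u 0) => [->|u0].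
    under eq_bigr => v _ do rewrite mul0r eq_sym.
    by rewrite sumr_const mul1r addrC subrK -mulr_natl natz.
  rewrite mul0r addr0 -[RHS](sum_indicator1 (u^-1 * d)).
  apply: eq_bigr => v _; congr (Posz (nat_of_bool _)).
  by apply/eqP/eqP => [<-|->]; rewrite ?mulKf ?mulVKf.
under eq_bigr => u _ do rewrite inner.
rewrite big_split /= -mulr_suml sum_indicator1 sumr_const mul1r natz.
by rewrite mulrDr mulr1 addrA.
Qed.

(** The sum counts the points of [v ^+ 2 = t ^+ 2 - d], a hyperbola in the coordinates [t + v] and
    [t - v]. *)
Lemma sum_quadchar_sqrB {F : finFieldType} (d : F) : 2 != 0 :> F ->
  \sum_(t : F) quadchar (t ^+ 2 - d) = #|F|%:Z * (d == 0)%:Z - 1.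
Proof.
move=> h2.
suff: \sum_(t : F) (1 + quadchar (t ^+ 2 - d))
    = #|F|%:Z * (1 + (d == 0)%:Z) - 1.
  rewrite big_split /= sumr_const natz mulrDr mulr1 -addrA.
  by move/addrI.
under eq_bigr => t _ do rewrite -sum_sqrt //.
rewrite -sum_hyperbola !pair_big /=.
pose g (q : F * F) : F * F := ((q.1 + q.2) / 2, (q.1 - q.2) / 2).
rewrite (reindex g) /=; last first.
  by exists (fun q => (q.1 + q.2, q.1 - q.2)) => -[u v] _;
    rewrite /g /=; congr pair; field.
apply: eq_bigr => -[u v] _ /=; congr (Posz (nat_of_bool _)).
rewrite -subr_eq0 -[RHS]subr_eq0 -[RHS]oppr_eq0.
by congr (_ == 0); field.
Qed.

Lemma sum_quadchar_quadratic {F : finFieldType} (a b c : F) :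
  2 != 0 :> F -> a != 0 ->
  \sum_(y : F) quadchar (a * y ^+ 2 + b * y + c)
    = quadchar a * (#|F|%:Z * (b ^+ 2 - 4 * a * c == 0)%:Z - 1).
Proof.
move=> h2 a0; rewrite -(sum_quadchar_sqrB _ h2) mulr_sumr.
rewrite [RHS](reindex (fun y : F => 2 * a * y + b)) /=; last first.
  by exists (fun t => (t - b) / (2 * a)) => t _; field; apply/andP.
apply: eq_bigr => y _; rewrite -quadcharM //.
(* Completing the square: [(2 * a) ^+ 2] times the quadratic is [a] times [(2 * a * y + b) ^+ 2 - (b
   ^+ 2 - 4 * a * c)]. *)
rewrite -[LHS](@quadchar_sqrMl F (2 * a)) ?mulf_neq0 //.
by congr quadchar; ring.
Qed.

Lemma sum_monic_quadratic_roots {F : finFieldType} (b c : F) : 2 != 0 :> F ->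
  \sum_(z : F) (z ^+ 2 + b * z + c == 0)%:Z = 1 + quadchar (b ^+ 2 - 4 * c).
Proof.
move=> h2; rewrite -sum_sqrt //.
rewrite [RHS](reindex (fun z : F => 2 * z + b)) /=; last first.
  by exists (fun t => (t - b) / 2) => t _; field.
apply: eq_bigr => z _; congr (Posz (nat_of_bool _)).
have h4 : 2 ^+ 2 != 0 :> F by rewrite expf_neq0.
(* The false disjunct [2 ^+ 2 == 0] multiplies the equation by [4], which completes the square. *)
rewrite -[RHS]subr_eq0 -[LHS]orFb -(negbTE h4) -mulf_eq0.
by congr (_ == 0); ring.
Qed.

Lemma sum_quadchar_linear {F : finFieldType} (b c : F) : 2 != 0 :> F ->
  \sum_(y : F) quadchar (b * y + c) = #|F|%:Z * (b == 0)%:Z * quadchar c.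
Proof.
move=> h2; case: (eqVneq b 0) => [->|b0].
  under eq_bigr => y _ do rewrite mul0r add0r.
  by rewrite sumr_const mulr1 -mulr_natl natz.
rewrite mulr0 mul0r -[RHS](sum_quadchar h2).
rewrite [RHS](reindex (fun y : F => b * y + c)) //.
by exists (fun t => (t - c) / b) => t _; field.
Qed.

(** * Point counts on the fibres and on the surface *)

(* [2] and [-2] are the zeros of the leading coefficient [x^2 - 4] of the
   discriminant; the first two terms alone give the generic fibre because
   [quadchar] vanishes at zero. *)
Lemma sum_fibre {F : finFieldType} (C D x : F) : 2 != 0 :> F ->
  \sum_(y : F) \sum_(z : F)
     (x ^+ 2 + y ^+ 2 + z ^+ 2 - x * y * z + C * (x + y + z) - D == 0)%:Z
  = #|F|%:Z
    + quadchar (x ^+ 2 - 4)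
      * (#|F|%:Z * (x ^+ 3 + (C - 2) * x ^+ 2 - (2 * C + D) * x
                    + (C ^+ 2 + 2 * D) == 0)%:Z - 1)
    + (x == 2)%:Z * (#|F|%:Z * (C == 0)%:Z * quadchar (D - 4))
    + (x == - 2)%:Z * (#|F|%:Z * quadchar (D - (4 - 2 * C - C ^+ 2 / 4))).
Proof.
move=> h2.
have h4 : 4 != 0 :> F.
  by have -> : 4 = 2 ^+ 2 :> F by [ring]; rewrite expf_neq0.
have two_neqN2 : (2 == - 2 :> F) = false.
  by apply/negbTE; rewrite -subr_eq0 (_ : 2 - - 2 = 4 :> F) //; ring.
have fibre_disc : \sum_(y : F) \sum_(z : F)
     (x ^+ 2 + y ^+ 2 + z ^+ 2 - x * y * z + C * (x + y + z) - D == 0)%:Z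
   = #|F|%:Z + \sum_(y : F) quadchar ((x ^+ 2 - 4) * y ^+ 2
        + (- 2 * C * (x + 2)) * y
        + (C ^+ 2 - 4 * x ^+ 2 - 4 * C * x + 4 * D)).
  rewrite -[#|F|%:Z]natz -(sumr_const F) -big_split /=.
  apply: eq_bigr => y _.
  transitivity (\sum_(z : F) (z ^+ 2 + (C - x * y) * z
      + (x ^+ 2 + y ^+ 2 + C * (x + y) - D) == 0)%:Z).
    by apply: eq_bigr => z _; congr (Posz (nat_of_bool (_ == 0))); ring.
  by rewrite sum_monic_quadratic_roots //; congr (1 + quadchar _); ring.
rewrite fibre_disc -!addrA; congr (_ + _).
case: (eqVneq x 2) => [->|x2].
  (* Here the discriminant is linear in [y] with slope [- 8 * C]; for [C = 0] it is the constant
     [4 * (D - 4)]. *)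
  rewrite two_neqN2 (_ : 2 ^+ 2 - 4 = 0 :> F); last by ring.
  rewrite quadchar0 !mul0r add0r addr0 mul1r.
  under eq_bigr => y _ do rewrite mul0r add0r.
  rewrite sum_quadchar_linear //.
  have -> : - 2 * C * (2 + 2) = - (2 * 4) * C by ring.
  rewrite mulf_eq0 oppr_eq0 mulf_eq0 (negbTE h2) (negbTE h4) /=.
  case: (eqVneq C 0) => [->|_]; last by rewrite !mulr0 !mul0r.
  congr (_ * _); rewrite -[RHS](quadchar_sqrMl _ _ h2).
  by congr quadchar; ring.
rewrite mul0r add0r.
case: (eqVneq x (- 2)) => [->|xN2].
  (* Here the discriminant does not depend on [y]: it is [4] times the argument of [quadchar] on the
     right. *)
  rewrite (_ : (- 2) ^+ 2 - 4 = 0 :> F); last by ring.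
  rewrite quadchar0 !mul0r add0r mul1r.
  under eq_bigr => y _ do rewrite mul0r add0r addNr mulr0 mul0r add0r.
  rewrite sumr_const -[LHS]mulr_natl natz.
  congr (_ * _); rewrite -[RHS](quadchar_sqrMl _ _ h2).
  by congr quadchar; field.
rewrite mul0r addr0.
have x2B4 : x ^+ 2 - 4 = (x - 2) * (x + 2) by ring.
have xD2 : x + 2 != 0 by rewrite addr_eq0.
rewrite sum_quadchar_quadratic //; last by rewrite x2B4 mulf_neq0 // subr_eq0.
congr (_ * (_ * (Posz (nat_of_bool _)) - 1)).
have nz : 4 ^+ 2 * (x + 2) != 0 by rewrite mulf_neq0 // expf_neq0.
rewrite -[RHS]orFb -(negbTE nz) -mulf_eq0.
by congr (_ == 0); ring.
Qed.

(** The terms [- quadchar (x ^+ 2 - 4)] of the fibres add up to the constant [1]. *)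
Lemma sum_surface {F : finFieldType} (C D : F) : 2 != 0 :> F ->
  \sum_(x : F) \sum_(y : F) \sum_(z : F)
     (x ^+ 2 + y ^+ 2 + z ^+ 2 - x * y * z + C * (x + y + z) - D == 0)%:Z
  = #|F|%:Z ^+ 2 + 1
    + (quadchar (D - (4 - 2 * C - C ^+ 2 / 4))
       + \sum_(x : F)
          (quadchar (x ^+ 2 - 4)
             * (x ^+ 3 + (C - 2) * x ^+ 2 - (2 * C + D) * x
                + (C ^+ 2 + 2 * D) == 0)%:Z
           + (x == 2)%:Z * ((C == 0)%:Z * quadchar (D - 4))))
      * #|F|%:Z.
Proof.
move=> h2.
have h4 : 4 != 0 :> F.
  by have -> : 4 = 2 ^+ 2 :> F by [ring]; rewrite expf_neq0.
have := sum_quadchar_sqrB 4 h2; rewrite (negbTE h4) mulr0 add0r => sumN1.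
under eq_bigr => x _ do rewrite sum_fibre // mulrBr mulr1.
rewrite !big_split /= sumrN sumN1 -!mulr_suml !sum_indicator1 sumr_const.
rewrite -[#|F|%:Z *+ _]mulr_natl natz.
under eq_bigr => x _ do rewrite mulrCA.
by rewrite -mulr_sumr; ring.
Qed.

(** * Evaluation at the roots of the cubic *)

Lemma horner_kappa (p : nat) (C D x : 'F_p) :
  (kappa C D).[x]
    = x ^+ 3 + (C - 2) * x ^+ 2 - (2 * C + D) * x + (C ^+ 2 + 2 * D).
Proof. by rewrite /kappa !hornerE. Qed.

Lemma N0_sum (p : nat) (T : finType) (g : T -> 'F_p) :
  (N0 g)%:Z = \sum_(v : T) (g v == 0)%:Z.
Proof.
rewrite /N0 -sum1_card big_mkcond /= -natz natr_sum.
by apply: eq_bigr => v _; rewrite natz inE; case: eqP.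
Qed.

Lemma sigmaE (p : nat) (a : 'F_p) : sigma a = quadchar a.
Proof. by []. Qed.

Lemma N0_f (p : nat) (C D : 'F_p) : prime p -> 2 != 0 :> 'F_p ->
  (N0 (f C D))%:Z = p%:Z ^+ 2 + 1
    + (quadchar (D - D_bullet C)
       + \sum_(x : 'F_p)
          (quadchar (x ^+ 2 - 4) * ((kappa C D).[x] == 0)%:Z
           + (x == 2)%:Z * ((C == 0)%:Z * quadchar (D - 4)))) * p%:Z.
Proof.
move=> p_prime h2.
have := sum_surface C D h2; rewrite (card_Fp p_prime) => surf.
rewrite N0_sum.
transitivity (\sum_(x : 'F_p) \sum_(y : 'F_p) \sum_(z : 'F_p)
     (f C D (x, y, z) == 0)%:Z).
  rewrite pair_big /= pair_big /=.
  by apply: eq_bigr => -[[x y] z] _.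
rewrite surf; congr (_ + (_ + _) * _).
by apply: eq_bigr => x _; rewrite horner_kappa.
Qed.

Theorem theorem6p1 (p : nat) (p_prime : prime p) (p_ge5 : (5 <= p)%N)
    (C D : 'F_p) :
  (D = D_bullet C ->
     (N0 (f C D))%:Z = p%:Z ^+ 2 + 1 + sigma (C ^+ 2 - 8 * C) * p%:Z)
  /\
  (D <> D_bullet C ->
     (N0 (f C D))%:Z =
       p%:Z ^+ 2 + 1
       + sigma (D - D_bullet C) * (1 + (N0 (horner (kappa C D)))%:Z) * p%:Z).
Proof.
have h2 : 2 != 0 :> 'F_p.
  rewrite -(dvdn_pcharf (pchar_Fp p_prime)).
  by apply/negP => /(@dvdn_leq _ 2 isT); rewrite leqNgt (leq_trans _ p_ge5).
have h4 : 4 != 0 :> 'F_p.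
  by have -> : 4 = 2 ^+ 2 :> 'F_p by [ring]; rewrite expf_neq0.
have kappaE (x : 'F_p) : (kappa C D).[x]
    = (x + 2) * (x - 2 + C / 2) ^+ 2 - (x - 2) * (D - D_bullet C).
  by rewrite horner_kappa /D_bullet; field; apply/andP.
rewrite !sigmaE N0_f //; split=> [DE | /eqP DN].
  rewrite {1}DE subrr quadchar0 add0r; congr (_ + _ * _).
  (* Now [kappa] is [(x + 2) * (x - 2 + C / 2) ^+ 2] and the character vanishes at [x = - 2], so
     only the root [2 - C / 2] contributes. *)
  rewrite -[RHS]mul1r -(sum_indicator1 (2 - C / 2)) mulr_suml.
  apply: eq_bigr => x _.
  have -> : (C == 0)%:Z * quadchar (D - 4) = 0.
    case: eqP => [C0|_]; last by rewrite mul0r.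
    rewrite DE /D_bullet C0 (_ : _ - 4 = 0) ?quadchar0 //.
    by field.
  rewrite mulr0 addr0 kappaE -DE subrr mulr0 subr0 mulf_eq0 expf_eq0 /=.
  case: (eqVneq x (2 - C / 2)) => [->|xC].
    rewrite (_ : 2 - C / 2 - 2 + C / 2 = 0); last by field.
    rewrite eqxx orbT mulr1 mul1r -[LHS](quadchar_sqrMl _ _ h2).
    by congr quadchar; field.
  have /negbTE -> : x - 2 + C / 2 != 0.
    by rewrite (_ : _ + _ = x - (2 - C / 2)) ?subr_eq0 //; field.
  rewrite orbF mul0r; case: eqP => [x2|_]; last by rewrite mulr0.
  have -> : x ^+ 2 - 4 = (x + 2) * (x - 2) by ring.
  by rewrite x2 mul0r.
congr (_ + _ * _); rewrite mulrDr mulr1; congr (_ + _).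
(* The fibre over [- 2] has supplied the summand [1]; the rest is compared for each [x]. *)
rewrite N0_sum mulr_sumr; apply: eq_bigr => x _.
have DN0 : D - D_bullet C != 0 by rewrite subr_eq0.
(* [kappa] takes the value [C ^+ 2] at [2], so [2] is a root only if [C = 0], and then
   [D_bullet C = 4]. *)
case: (eqVneq x 2) => [->|x2].
  rewrite (_ : 2 ^+ 2 - 4 = 0); last by ring.
  rewrite quadchar0 mul0r add0r mul1r kappaE subrr mul0r subr0 add0r.
  rewrite mulf_eq0 expf_eq0 mulf_eq0 invr_eq0 (negbTE h2) orbF.
  rewrite (_ : 2 + 2 = 4) ?(negbTE h4) /=; last by ring.
  rewrite mulrC; case: (eqVneq C 0) => [->|_]; last by rewrite !mulr0.
  by congr (quadchar _ * _); rewrite /D_bullet; field.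
rewrite mul0r addr0; case: eqP => [|_]; last by rewrite !mulr0.
rewrite kappaE => /eqP; rewrite subr_eq0 => /eqP root_x.
have x20 : x - 2 != 0 by rewrite subr_eq0.
have w0 : x - 2 + C / 2 != 0.
  apply: contraNneq (mulf_neq0 x20 DN0) => w0.
  by rewrite -root_x w0 expr0n mulr0.
(* At a root, [(x - 2 + C / 2) ^+ 2 * (x ^+ 2 - 4)] equals [(x - 2) ^+ 2 * (D - D_bullet C)]. *)
rewrite !mulr1 -[LHS](quadchar_sqrMl _ _ w0) -[RHS](quadchar_sqrMl _ _ x20).
rewrite [in RHS]expr2 -[in RHS]mulrA -root_x.
by congr quadchar; ring.
Qed.
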